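(* Let $p\in(0,1)$ be a constant. There exist an existential monadic second order sentence $\varphi_1$ using only 3 first order variables and an existential monadic second order sentence $\varphi_2$ using only 1 monadic variable such that, for both $j=1,2$, the probability ${\sf P}(G(n,p)\models\varphi_j)$ does not converge as $n\to\infty$.
   Context: $G(n,p)$ is the random graph on vertex set $\{1,\ldots,n\}$ in which each pair of vertices is joined by an edge independently with probability $p$. Sentences are about undirected graphs with relations $\sim$ (adjacency) and $=$. An existential monadic second order (EMSO) sentence is one of the form $\exists X_1\ldots\exists X_m\,\phi(X_1,\ldots,X_m)$, where the $X_i$ are monadic variables ranging over subsets of the vertex set and $\phi$ is a (finite) first order sentence in $\sim,=$ and the unary predicates $X_1,\ldots,X_m$; first order variables range over vertices. *)

(* Defs.v *)
From HB Require Import structures.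
From mathcomp Require Import all_boot all_order all_algebra.
From mathcomp Require Import reals.
Set Implicit Arguments. Unset Strict Implicit. Unset Printing Implicit Defensive.
Import Order.TTheory GRing.Theory Num.Theory.

(* First-order formulas over the language {~, =} extended with unary
   predicates (monadic variables).  First-order variables and monadic
   variables are named by natural numbers. *)
Inductive form : Type :=
| FAdj of nat & nat
| FEq  of nat & nat
| FIn  of nat & nat          (* FIn X x  :  x \in X_X *)
| FTrue
| FNot of form
| FAnd of form & form
| FOr  of form & form
| FImp of form & form
| FEx  of nat & form
| FAll of nat & form.

(* every first-order variable occurring in f (bound or in an atom) is < k,
   i.e. f uses only the k first-order variables 0,...,k-1 *)
Fixpoint fo_vars_lt (k : nat) (f : form) : bool :=
  match f with
  | FAdj x y | FEq x y => (x < k) && (y < k)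
  | FIn _ x => x < k
  | FTrue => true
  | FNot g => fo_vars_lt k g
  | FAnd g h | FOr g h | FImp g h => fo_vars_lt k g && fo_vars_lt k h
  | FEx x g | FAll x g => (x < k) && fo_vars_lt k g
  end.

Fixpoint mon_vars_lt (m : nat) (f : form) : bool :=
  match f with
  | FAdj _ _ | FEq _ _ | FTrue => true
  | FIn X _ => X < m
  | FNot g => mon_vars_lt m g
  | FAnd g h | FOr g h | FImp g h => mon_vars_lt m g && mon_vars_lt m h
  | FEx _ g | FAll _ g => mon_vars_lt m g
  end.

Fixpoint fo_closed_in (bd : seq nat) (f : form) : bool :=
  match f with
  | FAdj x y | FEq x y => (x \in bd) && (y \in bd)
  | FIn _ x => x \in bd
  | FTrue => true
  | FNot g => fo_closed_in bd g
  | FAnd g h | FOr g h | FImp g h => fo_closed_in bd g && fo_closed_in bd h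
  | FEx x g | FAll x g => fo_closed_in (x :: bd) g
  end.

(* An EMSO sentence  exists X_0 ... exists X_{m-1}, body  *)
Record emso := EMSO { emso_m : nat; emso_body : form }.

Definition emso_wf (s : emso) : bool :=
  fo_closed_in [::] (emso_body s) && mon_vars_lt (emso_m s) (emso_body s).

Definition emso_fo_vars_le (s : emso) (k : nat) : bool :=
  fo_vars_lt k (emso_body s).

Section Semantics.
Variable n : nat.
Local Notation V := 'I_n.

Definition upd (rho : nat -> option V) (x : nat) (v : V) : nat -> option V :=
  fun y => if y == x then Some v else rho y.

Fixpoint sat (adj : rel V) (sv : nat -> {set V}) (rho : nat -> option V)
    (f : form) : bool :=
  match f with
  | FAdj x y => if (rho x, rho y) is (Some a, Some b) then adj a b else false
  | FEq x y => if (rho x, rho y) is (Some a, Some b) then a == b else false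
  | FIn X x => if rho x is Some a then a \in sv X else false
  | FTrue => true
  | FNot g => ~~ sat adj sv rho g
  | FAnd g h => sat adj sv rho g && sat adj sv rho h
  | FOr g h => sat adj sv rho g || sat adj sv rho h
  | FImp g h => sat adj sv rho g ==> sat adj sv rho h
  | FEx x g => [exists v : V, sat adj sv (upd rho x v) g]
  | FAll x g => [forall v : V, sat adj sv (upd rho x v) g]
  end.

Definition emso_holds (adj : rel V) (s : emso) : bool :=
  [exists Xs : (emso_m s).-tuple {set V},
     sat adj (fun i => nth set0 Xs i) (fun _ => None) (emso_body s)].

(* potential edges {i,j}, encoded as pairs (i,j) with i < j *)
Definition pairs : {set V * V} := [set e : V * V | (val e.1 < val e.2)%N].

Definition adj_of (E : {set V * V}) : rel V :=
  fun x y => ((x, y) \in E) || ((y, x) \in E).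

Definition prob_Gnp (R : realType) (p : R) (s : emso) : R :=
  \sum_(E in powerset pairs)
     (p ^+ #|E| * (1 - p) ^+ (#|pairs| - #|E|)%N
      * (emso_holds (adj_of E) s)%:R)%R.

End Semantics.

Definition converges (R : realType) (u : nat -> R) : Prop :=
  exists l : R, forall eps : R, (0 < eps)%R ->
    exists N : nat, forall n : nat, (N <= n)%N -> (`|u n - l| < eps)%R.

(* Main.v *)
Require Import Defs.
From HB Require Import structures.
From mathcomp Require Import all_boot all_order all_algebra.
From mathcomp Require Import reals.
From mathcomp Require Import zify ring lra.
Set Implicit Arguments. Unset Strict Implicit. Unset Printing Implicit Defensive.
Import Order.TTheory GRing.Theory Num.Theory.
Local Open Scope ring_scope.

(** Passing to the complement graph if necessary, assume q = 1 - p <= 1/2.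
Both sentences say that there are vertex sets A and C such that C is
independent, A induces a perfect matching, the traces N(v) :&: A of arbitrary
vertices v are all attained in C, each by exactly one vertex of C, and A :|: C
is dominating.

Nonexistence.  With high probability every small set of vertices is shattered
by the neighbourhoods of the other vertices. Hence #|C| = 2 ^ #|A|, which is a
power of 4 because #|A| is even. Domination forces #|A :|: C| to be at least
about log n (base 1/q), and independence forces #|C| to be at most about twice
log n. For n about q^-(3/2 4^t) no power of 4 lies in this window, and the
probability tends to 0.

Existence.  Let H be the graph that A and C must induce when #|A| = 2t, let k
be its order, and split about 6 q^-k vertices into k blocks of sizes about
q^-i (k - i + 1). Choose in block i the first vertex that is correctly joined
to the vertices chosen before. Since p >= q, a given vertex is suitable with
probability at least q^i. The event that the search outputs a given copy of H
and that this copy is dominating is a product over the vertices, and summing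
over all copies bounds the probability below by
(1 - q^k)^n \prod_i (1 - (1 - q^i)^(N_i)), where N_i is the size of block i.
This stays away from 0. *)

(** * Independent coin tosses *)

Section Bernoulli.
Variables (R : realFieldType) (T : finType) (p : R).
Hypotheses (p_ge0 : 0 <= p) (p_le1 : p <= 1).
Implicit Types (g h : {ffun T -> bool}) (F G : pred {ffun T -> bool}).

Definition coin (b : bool) : R := if b then p else 1 - p.
Definition mass g : R := \prod_e coin (g e).
Definition Pr F : R := \sum_(g | F g) mass g.

Definition depends (D : {set T}) F :=
  forall g h, (forall e, e \in D -> g e = h e) -> F g = F h.

Lemma coin_ge0 b : 0 <= coin b.
Proof. by case: b; rewrite /coin ?subr_ge0. Qed.

Lemma mass_ge0 g : 0 <= mass g.
Proof. by apply: prodr_ge0 => e _; apply: coin_ge0. Qed.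

Lemma Pr_ge0 F : 0 <= Pr F.
Proof. by apply: sumr_ge0 => g _; apply: mass_ge0. Qed.

Lemma eq_Pr F G : F =1 G -> Pr F = Pr G.
Proof. by move=> FG; apply: eq_bigl. Qed.

Lemma sum_mass : \sum_g mass g = 1.
Proof.
rewrite -(bigA_distr_bigA (fun _ : T => coin)) /= big1 // => e _.
by rewrite big_bool /coin /= addrC subrK.
Qed.

Lemma PrT : Pr xpredT = 1.
Proof. exact: sum_mass. Qed.

Lemma Pr_compl F : Pr (fun g => ~~ F g) = 1 - Pr F.
Proof. by rewrite -sum_mass (bigID F) /= /Pr addrC addrK. Qed.

Lemma le_Pr F G : (forall g, F g -> G g) -> Pr F <= Pr G.
Proof.
move=> FG; rewrite /Pr [X in _ <= X](bigID F) /=.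
rewrite (eq_bigl F) => [|g]; last by case: (boolP (F g)) => [/FG ->|]; rewrite ?andbF.
by rewrite lerDl; apply: sumr_ge0 => g _; apply: mass_ge0.
Qed.

Lemma PrE F : Pr F = \sum_g mass g * (F g)%:R.
Proof.
by rewrite /Pr big_mkcond; apply: eq_bigr => g _; case: (F g); rewrite ?mulr1 ?mulr0.
Qed.

Lemma Pr_union (I : finType) F (G : I -> pred {ffun T -> bool}) :
  (forall g, F g -> exists i, G i g) -> Pr F <= \sum_i Pr (G i).
Proof.
move=> FG; under eq_bigr do rewrite PrE.
rewrite exchange_big PrE; apply: ler_sum => g _; rewrite -mulr_sumr.
apply: ler_wpM2l; first exact: mass_ge0.
have [/FG[i Gi]|_] := boolP (F g); last by apply: sumr_ge0 => i _; case: (G i g).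
by rewrite (bigD1 i) //= Gi lerDl; apply: sumr_ge0 => j _; case: (G j g).
Qed.

(** At every outcome at most one [G i] holds, so the indicators of the [G i] sum to at most that of
    [F]. It serves to add up the probabilities of the possible outputs of the greedy search. *)
Lemma Pr_disjoint (I : finType) (P : pred I) F (G : I -> pred {ffun T -> bool}) :
    (forall i g, P i -> G i g -> F g) ->
    (forall i j g, P i -> P j -> G i g -> G j g -> i = j) ->
  \sum_(i | P i) Pr (G i) <= Pr F.
Proof.
move=> GF Gdisj; under eq_bigr do rewrite PrE.
rewrite exchange_big PrE; apply: ler_sum => g _; rewrite -mulr_sumr.
apply: ler_wpM2l; first exact: mass_ge0.
have [/existsP[i /andP[Pi Gi]]|] := boolP [exists i, P i && G i g].
  rewrite (bigD1 i) //= Gi (GF i g) // big1 ?addr0 // => j /andP[Pj ji].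
  by have [Gj|//] := boolP (G j g); rewrite (Gdisj i j g) ?eqxx in ji.
rewrite negb_exists => /forallP no; rewrite big1 // => i Pi.
by have := no i; rewrite Pi /= => /negbTE ->.
Qed.

(* Exchanging the coordinates outside [D] of two independent samples preserves
   their joint law and turns [F g && G g] into [F g && G h]. *)
Lemma Pr_indep2 (D : {set T}) F G : depends D F -> depends (~: D) G ->
  Pr (fun g => F g && G g) = Pr F * Pr G.
Proof.
move=> dF dG.
pose mix g h : {ffun T -> bool} := [ffun e => if e \in D then g e else h e].
pose sw (x : {ffun T -> bool} * {ffun T -> bool}) := (mix x.1 x.2, mix x.2 x.1).
have swK : involutive sw.
  by case=> g h; congr pair; apply/ffunP => e; rewrite !ffunE; case: (e \in D).
rewrite [LHS]PrE -[LHS]mulr1 -[X in _ * X]sum_mass !PrE !mulr_suml.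
transitivity (\sum_x mass x.1 * mass x.2 * (F x.1 && G x.1)%:R).
  rewrite -(pair_bigA _ (fun g h => mass g * mass h * (F g && G g)%:R)) /=.
  apply: eq_bigr => g _; rewrite mulr_sumr; apply: eq_bigr => h _.
  by rewrite mulrAC.
rewrite (reindex_inj (inv_inj swK)) /=.
transitivity (\sum_x mass x.1 * mass x.2 * (F x.1 && G x.2)%:R); last first.
  rewrite -(pair_bigA _ (fun g h => mass g * mass h * (F g && G h)%:R)) /=.
  apply: eq_bigr => g _; rewrite mulr_sumr; apply: eq_bigr => h _.
  by rewrite mulrACA -mulnb natrM.
apply: eq_bigr => -[g h] _ /=; congr (_ * (_ && _)%:R).
- rewrite /mass -!big_split; apply: eq_bigr => e _ /=; rewrite !ffunE.
  by case: (e \in D); rewrite // mulrC.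
- by apply: dF => e eD; rewrite ffunE eD.
- by apply: dG => e; rewrite inE => /negbTE eD; rewrite ffunE eD.
Qed.

(** The events in the tail read only coins outside [D i], so [Pr_indep2] splits off the head. *)
Lemma Pr_indep_seq (I : eqType) (s : seq I) (D : I -> {set T})
    (F : I -> pred {ffun T -> bool}) :
    uniq s -> {in s, forall i, depends (D i) (F i)} ->
    {in s &, forall i j, i != j -> [disjoint D i & D j]} ->
  Pr (fun g => all (F^~ g) s) = \prod_(i <- s) Pr (F i).
Proof.
elim: s => [|i s IH] /=; first by rewrite big_nil PrT.
case/andP=> nis us dF dD; rewrite big_cons -IH //; last first.
- by move=> x y xs ys; apply: dD; rewrite inE ?xs ?ys orbT.
- by move=> x xs; apply: dF; rewrite inE xs orbT.
apply: (@Pr_indep2 (D i)); first by apply: dF; rewrite mem_head.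
move=> g h gh; apply: eq_in_all => j js.
apply: dF => [|e eD]; first by rewrite inE js orbT.
apply: gh; rewrite inE.
have ij : i != j by apply: contraNneq nis => ->.
have := dD i j (mem_head _ _) _ ij; rewrite inE js orbT => /(_ isT).
by rewrite disjoint_sym => /disjointFr ->.
Qed.

Lemma Pr_indep (I : finType) (P : pred I) (D : I -> {set T})
    (F : I -> pred {ffun T -> bool}) :
    (forall i, P i -> depends (D i) (F i)) ->
    (forall i j, P i -> P j -> i != j -> [disjoint D i & D j]) ->
  Pr (fun g => [forall (i | P i), F i g]) = \prod_(i | P i) Pr (F i).
Proof.
move=> dF dD; rewrite -[RHS]big_filter.
rewrite -(Pr_indep_seq (D := D)).
- apply: eq_Pr => g; apply/forall_inP/allP => [H i|H i Pi].
    by rewrite mem_filter => /andP[/H].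
  by apply: H; rewrite mem_filter Pi mem_index_enum.
- by rewrite filter_uniq ?index_enum_uniq.
- by move=> i; rewrite mem_filter => /andP[/dF].
- by move=> i j; rewrite !mem_filter => /andP[Pi _] /andP[Pj _]; apply: dD.
Qed.

Lemma Pr_coin e (b : bool) : Pr (fun g => g e == b) = coin b.
Proof.
rewrite PrE.
(* The constraint at [e] becomes a factor at every coordinate, equal to 1 away from [e], so that the
   sum of products factors. *)
transitivity (\sum_(g : {ffun T -> bool}) \prod_e' (coin (g e') * ((e' == e) ==> (g e' == b))%:R)).
  apply: eq_bigr => g _; rewrite big_split /=; congr (_ * _).
  by rewrite (bigD1 e) //= eqxx /= big1 ?mulr1 // => e'; move/negbTE=> ->.
rewrite -(bigA_distr_bigA (fun e' c => coin c * ((e' == e) ==> (c == b))%:R)) /=.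
rewrite (bigD1 e) //= big_bool big1; last first.
  by move=> e' /negbTE ne; rewrite big_bool ne /= !mulr1 /coin /= addrC subrK.
by rewrite eqxx /=; case: b; rewrite /= !(mulr1, mulr0) ?addr0 ?add0r.
Qed.

Lemma Pr_pattern (J : finType) (P : pred J) (e : J -> T) (h : J -> bool) :
    {in P &, injective e} ->
  Pr (fun g => [forall (j | P j), g (e j) == h j]) = \prod_(j | P j) coin (h j).
Proof.
move=> inj_e; rewrite (Pr_indep (D := fun j => [set e j])).
- by apply: eq_bigr => j _; apply: Pr_coin.
- by move=> j _ g g' gg'; rewrite gg' ?set11.
- move=> i j Pi Pj ij; rewrite disjoints1 inE.
  by apply: contraNneq ij => /inj_e ->.
Qed.

End Bernoulli.

(** Flipping every coin permutes the outcomes; this is how complementing the graph exchanges [p] and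
    [1 - p]. *)
Lemma Pr_neg (R : realFieldType) (T : finType) (p : R) (F : pred {ffun T -> bool}) :
  Pr p (fun g => F [ffun e => ~~ g e]) = Pr (1 - p) F.
Proof.
rewrite /Pr [RHS](reindex_inj (h := fun g : {ffun T -> bool} => [ffun e => ~~ g e])) /=; last first.
  by apply: (can_inj (g := fun g : {ffun T -> bool} => [ffun e => ~~ g e])) => g;
     apply/ffunP => e; rewrite !ffunE negbK.
apply: eq_bigr => g _; apply: eq_bigr => e _; rewrite ffunE /coin.
by case: (g e); rewrite //= subKr.
Qed.

(** * The random graph *)

Section Graph.
Variable n : nat.
Local Notation V := 'I_n.
Implicit Types (g : {ffun V * V -> bool}) (x y v : V).

Definition edge x y : V * V := if (x < y)%N then (x, y) else (y, x).

(** There is a coin for every ordered pair, but only the coins of increasing pairs are read; the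
    others sum out to 1. *)
Definition adjg g : rel V := fun x y => (x != y) && g (edge x y).

Lemma edgeC x y : edge x y = edge y x.
Proof. by rewrite /edge; case: ltngtP => // /val_inj ->. Qed.

Lemma adjgC g x y : adjg g x y = adjg g y x.
Proof. by rewrite /adjg edgeC eq_sym. Qed.

Lemma adjgxx g x : adjg g x x = false.
Proof. by rewrite /adjg eqxx. Qed.

Lemma edge_eq x y x' y' : edge x y = edge x' y' ->
  (x = x' /\ y = y') \/ (x = y' /\ y = x').
Proof.
by rewrite /edge; case: ifP => _; case: ifP => _ [-> ->]; [left|right|right|left].
Qed.

Lemma adj_ofE g : adj_of [set e in pairs n | g e] =2 adjg g.
Proof.
move=> x y; rewrite /adj_of /adjg /edge !inE /=.
by case: (ltngtP x y) => [xy|yx|/val_inj ->]; rewrite ?ltnn ?eqxx //=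
  ?orbF // -val_eqE /= ?(ltn_eqF xy) ?(gtn_eqF yx).
Qed.

Lemma eq_sat (r r' : rel V) sv rho f : r =2 r' -> sat r sv rho f = sat r' sv rho f.
Proof.
move=> rr'; elim: f rho => //=.
- by move=> x y rho; case: (rho x) => // a; case: (rho y) => // b; rewrite rr'.
- by move=> f IHf rho; rewrite IHf.
- by move=> f IHf h IHh rho; rewrite IHf IHh.
- by move=> f IHf h IHh rho; rewrite IHf IHh.
- by move=> f IHf h IHh rho; rewrite IHf IHh.
- by move=> x f IHf rho; apply: eq_existsb => v; apply: IHf.
- by move=> x f IHf rho; apply: eq_forallb => v; apply: IHf.
Qed.

Lemma eq_emso_holds (r r' : rel V) s : r =2 r' -> emso_holds r s = emso_holds r' s.
Proof. by move=> rr'; apply: eq_existsb => Xs; apply: eq_sat. Qed.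

(** Outcomes are grouped by the edge set [E] that they define. Such a group fixes exactly the coins
    of [pairs n], so its mass is the weight of [E]. *)
Lemma prob_GnpE (R : realType) (p : R) s :
  prob_Gnp n p s = Pr p (fun g => emso_holds (adjg g) s).
Proof.
rewrite PrE (partition_big (fun g => [set e in pairs n | g e]) (mem (powerset (pairs n)))) /=; last first.
  by move=> g _; rewrite inE; apply/subsetP => e; rewrite inE => /andP[].
rewrite /prob_Gnp; apply: eq_bigr => E; rewrite inE => sE.
rewrite (eq_bigr (fun g => mass p g * (emso_holds (adj_of E) s)%:R)); last first.
  by move=> g /eqP <-; rewrite (eq_emso_holds _ (adj_ofE g)).
rewrite -mulr_suml; congr (_ * _).
transitivity (Pr p (fun g => [forall (e | e \in pairs n), g e == (e \in E)])); last first.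
  apply: eq_bigl => g; apply/forall_inP/eqP => [H|<- e eP]; last by rewrite inE eP.
  apply/setP => e; rewrite inE; case: (boolP (e \in pairs n)) => [/H/eqP ->//|].
  by move=> eP; apply/esym/negbTE; apply: contraNN eP; apply: (subsetP sE).
rewrite (@Pr_pattern _ _ p _ _ id); last by [].
rewrite (bigID (mem E)) /=; congr (_ * _).
  rewrite (eq_bigr (fun=> p)) => [|e /andP[_ ->]//].
  rewrite (eq_bigl (fun e => e \in E)) ?prodr_const // => e.
  by apply: andb_idl; apply: (subsetP sE).
rewrite (eq_bigr (fun=> 1 - p)) => [|e /andP[_ /negbTE ->]//].
rewrite (eq_bigl (fun e => e \in pairs n :\: E)) ?prodr_const ?cardsDS // => e.
by rewrite [RHS]inE andbC.
Qed.

End Graph.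

(** * The sentences *)

Definition FIff f g := FAnd (FImp f g) (FImp g f).

(* [pol = false] replaces adjacency by adjacency in the complement graph. *)
Definition FRel (pol : bool) x y :=
  if pol then FAdj x y else FAnd (FNot (FAdj x y)) (FNot (FEq x y)).

(** [A] and [C] are parameters, so that both sentences are instances of one formula. The clauses
    reuse the variables 0, 1, 2, which keeps [phi1] within three and leaves 3 for the extra vertex
    of [phi2]. *)
Definition goodF (r : nat -> nat -> Defs.form) (A C : nat -> Defs.form) : Defs.form :=
  FAnd (FAll 0 (FAll 1 (FImp (FAnd (C 0) (C 1)) (FNot (r 0 1))))) (
  FAnd (FAll 0 (FImp (A 0) (FEx 1 (FAnd (FAnd (A 1) (r 0 1))
          (FAll 2 (FImp (FAnd (A 2) (r 0 2)) (FEq 2 1))))))) (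
  FAnd (FAll 0 (FAll 1 (FImp (FAnd (C 0) (C 1))
          (FImp (FAll 2 (FImp (A 2) (FIff (r 2 0) (r 2 1)))) (FEq 0 1))))) (
  FAnd (FAll 0 (FEx 1 (FAnd (C 1) (FAll 2 (FImp (A 2) (FIff (r 2 0) (r 2 1)))))))
       (FAll 0 (FOr (FOr (A 0) (C 0)) (FEx 1 (FAnd (FOr (A 1) (C 1)) (r 0 1)))))))).

Definition phi1 (pol : bool) : emso :=
  EMSO 2 (goodF (FRel pol) (FIn 0) (FIn 1)).

(* A single set [X] and a vertex [u] encode the two sets [A = X :&: N(u)] and
   [C = X :\: N(u)]. *)
Definition phi2 (pol : bool) : emso :=
  EMSO 1 (FEx 3 (goodF (FRel pol) (fun x => FAnd (FIn 0 x) (FRel pol 3 x))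
                                  (fun x => FAnd (FIn 0 x) (FNot (FRel pol 3 x))))).

(** * Semantic form of the sentences *)

Section Good.
Variable n : nat.
Local Notation V := 'I_n.

Definition pol_rel (pol : bool) (r : rel V) : rel V :=
  fun x y => if pol then r x y else ~~ r x y && ~~ (x == y).

Definition good (r : rel V) (a c : V -> bool) : Prop :=
  [/\ forall x y, c x -> c y -> ~~ r x y,
      forall x, a x -> exists y, [/\ a y, r x y & forall z, a z -> r x z -> z = y],
      forall x y, c x -> c y -> (forall z, a z -> r z x = r z y) -> x = y,
      forall x, exists2 y, c y & forall z, a z -> r z x = r z y &
      forall x, a x || c x \/ exists2 y, a y || c y & r x y].

(** This copies the shape that [sat] gives to [goodF], so that the two agree by computation once
    [pol] is known. *)
Definition goodb (r : rel V) (a c : V -> bool) : bool :=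
  [&& [forall x, [forall y, (c x && c y) ==> ~~ r x y]],
      [forall x, a x ==> [exists y, (a y && r x y) &&
         [forall z, (a z && r x z) ==> (z == y)]]],
      [forall x, [forall y, (c x && c y) ==>
         ([forall z, a z ==> ((r z x ==> r z y) && (r z y ==> r z x))] ==> (x == y))]],
      [forall x, [exists y, c y &&
         [forall z, a z ==> ((r z x ==> r z y) && (r z y ==> r z x))]]] &
      [forall x, (a x || c x) || [exists y, (a y || c y) && r x y]]].

Lemma goodP (r : rel V) (a c : V -> bool) : reflect (good r a c) (goodb r a c).
Proof.
have eqb (b b' : bool) : (b ==> b') && (b' ==> b) = (b == b') by case: b; case: b'.
have trP x y : reflect (forall z, a z -> r z x = r z y)
    [forall z, a z ==> ((r z x ==> r z y) && (r z y ==> r z x))].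
  by apply: (iffP forallP) => H z; [move=> az; have := H z; rewrite az /= eqb => /eqP
    |apply/implyP => /H; rewrite eqb => ->].
apply: (iffP and5P) => -[H1 H2 H3 H4 H5]; split.
- by move=> x y cx cy; move/forallP/(_ x)/forallP/(_ y): H1; rewrite cx cy.
- move=> x ax; move/forallP/(_ x): H2; rewrite ax /=.
  move=> /existsP[y /andP[/andP[ay xy] /forallP H]].
  by exists y; split=> // z az xz; have := H z; rewrite az xz => /eqP.
- move=> x y cx cy /trP xy; move/forallP/(_ x)/forallP/(_ y): H3.
  by rewrite cx cy xy => /eqP.
- by move=> x; move/forallP/(_ x)/existsP: H4 => [y /andP[cy /trP]]; exists y.
- move=> x; move/forallP/(_ x)/orP: H5 => [|/existsP[y /andP[yS xy]]]; first by left.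
  by right; exists y.
- by apply/forallP => x; apply/forallP => y; apply/implyP => /andP[]; apply: H1.
- apply/forallP => x; apply/implyP => /H2[y [ay xy H]].
  apply/existsP; exists y; rewrite ay xy /=.
  by apply/forallP => z; apply/implyP => /andP[az /(H z az)->].
- apply/forallP => x; apply/forallP => y; apply/implyP => /andP[cx cy].
  by apply/implyP => /trP/(H3 x y cx cy) ->.
- apply/forallP => x; have [y cy /trP xy] := H4 x.
  by apply/existsP; exists y; rewrite cy.
- apply/forallP => x; have [->//|[y yS xy]] := H5 x.
  by apply/orP; right; apply/existsP; exists y; rewrite yS.
Qed.

Lemma phi1_good pol (r : rel V) :
  emso_holds r (phi1 pol) -> exists a c, good (pol_rel pol r) a c.
Proof.
case/existsP=> Xs H.
exists (fun x => x \in nth set0 Xs 0), (fun x => x \in nth set0 Xs 1).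
by apply/goodP; case: pol Xs H.
Qed.

Lemma phi2_good pol (r : rel V) :
  emso_holds r (phi2 pol) -> exists a c, good (pol_rel pol r) a c.
Proof.
case/existsP=> Xs /existsP[u H].
exists (fun x => (x \in nth set0 Xs 0) && pol_rel pol r u x).
exists (fun x => (x \in nth set0 Xs 0) && ~~ pol_rel pol r u x).
by apply/goodP; case: pol Xs H.
Qed.

Lemma good_phi1 pol (r : rel V) (A C : {set V}) :
    good (pol_rel pol r) (fun x => x \in A) (fun x => x \in C) ->
  emso_holds r (phi1 pol).
Proof. by move/goodP=> H; apply/existsP; exists [tuple A; C]; case: pol H. Qed.

Lemma good_phi2 pol (r : rel V) (X : {set V}) u :
    good (pol_rel pol r) (fun x => (x \in X) && pol_rel pol r u x)
                         (fun x => (x \in X) && ~~ pol_rel pol r u x) ->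
  emso_holds r (phi2 pol).
Proof.
move/goodP=> H; apply/existsP; exists [tuple X]; apply/existsP; exists u.
by case: pol H.
Qed.

Lemma eq_good (r r' : rel V) a c : r =2 r' -> good r a c -> good r' a c.
Proof.
move=> rr' [H1 H2 H3 H4 H5]; split.
- by move=> x y cx cy; rewrite -rr' H1.
- move=> x /H2[y [ay xy H]]; exists y; split; rewrite -?rr' // => z az.
  by rewrite -rr'; apply: H.
- by move=> x y cx cy H; apply: H3 => // z az; rewrite !rr' H.
- by move=> x; have [y cy H] := H4 x; exists y => // z az; rewrite -!rr' H.
- by move=> x; have [|[y yS xy]] := H5 x; [left|right; exists y; rewrite -?rr'].
Qed.

Lemma pol_relE (pol : bool) (g : {ffun V * V -> bool}) :
  pol_rel pol (adjg g) =2 adjg (if pol then g else [ffun e => ~~ g e]).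
Proof.
move=> x y; rewrite /pol_rel /adjg; case: pol => //; rewrite ffunE.
by case: eqVneq; rewrite //= andbT.
Qed.

End Good.

Lemma phi1_wf pol : emso_wf (phi1 pol). Proof. by case: pol. Qed.
Lemma phi1_fo_vars pol : emso_fo_vars_le (phi1 pol) 3. Proof. by case: pol. Qed.
Lemma phi2_wf pol : emso_wf (phi2 pol). Proof. by case: pol. Qed.

(** * The obstruction *)

(** Deleting a vertex together with its partner leaves the rest matched, so induction removes two
    vertices at a time. *)
Lemma matched_even (T : finType) (r : rel T) (A : {set T}) :
    symmetric r -> irreflexive r ->
    (forall x, x \in A -> exists y,
       [/\ y \in A, r x y & forall z, z \in A -> r x z -> z = y]) ->
  ~~ odd #|A|.
Proof.
move=> rC rxx; have [m] := ubnP #|A|; elim: m A => // m IH A leAm matched.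
have [->|[x xA]] := set_0Vmem A; first by rewrite cards0.
have [y [yA xy uy]] := matched x xA.
have yx : y != x by apply: contraTneq xy => ->; rewrite rxx.
have yAx : y \in A :\ x by rewrite !inE yx.
rewrite (cardsD1 x) xA (cardsD1 y) yAx /= negbK; apply: IH.
  by move: leAm; rewrite (cardsD1 x) xA (cardsD1 y) yAx /=; lia.
move=> z; rewrite !inE => /and3P[zy zx zA].
have [w [wA zw uw]] := matched z zA; exists w; split=> //; last first.
  by move=> w'; rewrite !inE => /and3P[_ _]; apply: uw.
(* The partner [w] of [z] survives: [w = y] would make both [x] and [z] the partner of [y], and
   [w = x] would make [z] the partner of [x], which is [y]. *)
rewrite !inE wA andbT; apply/andP; split; apply/eqP => ew.
  have [v [_ _ uv]] := matched y yA.
  by move: zx; rewrite (uv z zA) 1?rC -?ew // -(uv x xA) ?eqxx // rC.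
by move: zy; rewrite (uy z zA) ?eqxx // -ew rC.
Qed.

Lemma set_injection (T : finType) (S : {set T}) s : (s <= #|S|)%N ->
  exists2 f : {ffun 'I_s -> T}, injective f & forall i, f i \in S.
Proof.
move=> le_s; exists [ffun i => enum_val (widen_ord le_s i)].
  by move=> i j; rewrite !ffunE => /enum_val_inj [] /val_inj.
by move=> i; rewrite ffunE enum_valP.
Qed.

(** Listing [S] before its complement, the first [s] entries pad [S] to exactly [s] points. The
    shattering hypothesis speaks of families of a fixed length, hence the padding. *)
Lemma set_cover (T : finType) (S : {set T}) s : (0 < s)%N -> (#|S| <= s <= #|T|)%N ->
  exists2 f : {ffun 'I_s -> T}, injective f & forall x, x \in S -> exists i, x = f i.
Proof.
move=> s_gt0 /andP[leS les]; pose l := enum S ++ enum (~: S).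
have ul : uniq l.
  rewrite cat_uniq !enum_uniq andbT /=; apply/hasPn => x.
  by rewrite !mem_enum inE.
have sl : size l = #|T| by rewrite size_cat -!cardE cardsC.
have [x0 _] : exists x0 : T, true.
  have : (0 < #|T|)%N by apply: leq_trans les.
  by case/card_gt0P => x _; exists x.
exists [ffun i : 'I_s => nth x0 l i].
  move=> i j; rewrite !ffunE => /eqP; rewrite nth_uniq ?sl //.
  - by move/eqP/val_inj.
  - by apply: leq_trans les.
  - by apply: leq_trans les.
move=> x xS; have lx : (index x l < s)%N.
  rewrite /l index_cat mem_enum xS (leq_trans _ leS) // cardE.
  by rewrite index_mem mem_enum.
by exists (Ordinal lx); rewrite ffunE nth_index // mem_cat mem_enum xS.
Qed.

Section Obstruction.
Variables (n : nat) (r : rel 'I_n) (t : nat).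
Hypotheses (rC : symmetric r) (rxx : irreflexive r).
Local Notation V := 'I_n.
Local Notation K := (4 ^ t + t.*2)%N.
Hypothesis t_gt0 : (0 < t)%N.
Hypothesis K_le : (K <= n)%N.
Hypothesis no_indep : forall f : {ffun 'I_(4 ^ t.+1) -> V}, injective f ->
  exists j i : 'I_(4 ^ t.+1), (i < j)%N && r (f j) (f i).
Hypothesis shatter : forall (f : {ffun 'I_K -> V}) (h : {ffun 'I_K -> bool}),
  injective f -> exists v, v \notin codom f /\ forall j, r v (f j) = h j.

Lemma shatter_set (S T : {set V}) : (#|S| <= K)%N ->
  exists2 v, v \notin S & forall x, x \in S -> r v x = (x \in T).
Proof.
move=> leS; have [||f inj_f fS] := @set_cover _ S K; rewrite ?leS ?card_ord ?addn_gt0 ?expn_gt0 //.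
have [v [vf H]] := shatter [ffun j => f j \in T] inj_f.
exists v => [|x /fS[i ->]]; last by rewrite H ffunE.
by apply: contraNN vf => /fS[i ->]; apply: codom_f.
Qed.

(** If [A] had [2t + 2] vertices, shattering them would produce [4 ^ t.+1] traces and as many
    vertices of [C], too many for an independent set. By parity [A] has at most [2t] vertices, so
    [C] has at most [4 ^ t]. Then [A :|: C] has size at most [K] and is small enough to be
    shattered, which contradicts domination. *)
Lemma no_good a c : ~ good r a c.
Proof.
case=> Cind Amatch twinfree traces dom.
pose A := [set x | a x]; pose C := [set x | c x].
have ltC : (#|C| < 4 ^ t.+1)%N.
  rewrite ltnNge; apply/negP => /set_injection[f inj_f fC].
  have [j [i /andP[_]]] := no_indep inj_f; apply/negP.
  by apply: Cind; [have := fC j|have := fC i]; rewrite inE.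
have ltA : (#|A| < t.*2.+2)%N.
  rewrite ltnNge; apply/negP => /set_injection[f inj_f fA].
  pose A' := [set f i | i in 'I_t.*2.+2].
  have cA' : #|A'| = t.*2.+2 by rewrite card_imset // card_ord.
  have A'A x : x \in A' -> a x by case/imsetP => i _ ->; have := fA i; rewrite inE.
  suff: (#|powerset A'| <= #|C|)%N.
    rewrite card_powerset cA' leqNgt -doubleS -mul2n expnM; exact/negP/negPn.
  apply: (leq_trans _ (leq_imset_card (fun y => [set z in A' | r z y]) _)).
  apply/subset_leq_card/subsetP => T; rewrite inE => /subsetP TA'.
  have [|v _ vT] := @shatter_set A' T.
    rewrite cA' addnC -addn2 leq_add2l; have := @leq_pexp2l 4 1 t isT t_gt0; lia.
  have [y cy ty] := traces v.
  apply/imsetP; exists y; first by rewrite inE.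
  apply/setP => z; rewrite inE; case: (boolP (z \in A')) => /= [zA'|zA'].
    by rewrite -ty ?A'A // rC vT.
  by apply/negbTE; apply: contraNN zA'; apply: TA'.
have evA : ~~ odd #|A|.
  apply: (matched_even rC rxx) => x; rewrite inE => /Amatch[y [ay xy uy]].
  by exists y; rewrite inE; split=> // z; rewrite inE; apply: uy.
have leA : (#|A| <= t.*2)%N by move: ltA evA; lia.
have leC : (#|C| <= 4 ^ t)%N.
  have -> : (4 ^ t = 2 ^ t.*2)%N by rewrite -mul2n expnM.
  apply: (@leq_trans (2 ^ #|A|)); last by rewrite leq_pexp2l.
  rewrite -card_powerset -(card_in_imset (f := fun y => [set z in A | r z y])).
    apply/subset_leq_card/subsetP => _ /imsetP[y _ ->]; rewrite inE.
    by apply/subsetP => z; rewrite inE => /andP[].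
  move=> x y; rewrite !inE => cx cy /setP xy; apply: twinfree => // z az.
  by have := xy z; rewrite !inE az.
(* The empty trace yields an undominated vertex. *)
have [|v vS H] := @shatter_set (A :|: C) set0.
  by apply: leq_trans (leq_card_setU _ _) _; rewrite addnC leq_add.
have [vS'|[y yS vy]] := dom v; first by rewrite !inE vS' in vS.
by have := H y; rewrite !inE vy yS => /(_ isT).
Qed.
End Obstruction.

(** * Independence of adjacencies at different vertices *)

Section Neighbourhoods.
Variables (R : realFieldType) (p : R) (n : nat).
Local Notation V := 'I_n.
Implicit Types (g : {ffun V * V -> bool}) (x y v : V).

(** These are the coins that decide the adjacency of [v] to the chosen [f j]; independence below
    comes from disjoint stars. *)
Definition star (J : finType) v (f : J -> V) (P : pred J) : {set V * V} :=
  [set edge v (f j) | j in P].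

Lemma depends_star (J : finType) v (f : J -> V) (P : pred J) F :
    (forall g g', (forall j, P j -> adjg g v (f j) = adjg g' v (f j)) -> F g = F g') ->
  depends (star v f P) F.
Proof.
move=> H g g' gg'; apply: H => j Pj; rewrite /adjg gg' //.
by apply/imsetP; exists j.
Qed.

Lemma star_disjoint (J : finType) v v' (f : J -> V) (P P' : pred J) :
    (forall j j', P j -> P' j' -> edge v (f j) <> edge v' (f j')) ->
  [disjoint star v f P & star v' f P'].
Proof.
move=> H; apply/pred0P => e /=; apply/negP => /andP[/imsetP[j Pj ->] /imsetP[j' Pj']].
exact: H.
Qed.

Lemma Pr_star (J : finType) v (f : J -> V) (P : pred J) (h : J -> bool) :
    injective f -> (forall j, P j -> v != f j) ->
  Pr p (fun g => [forall (j | P j), adjg g v (f j) == h j]) =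
  \prod_(j | P j) coin p (h j).
Proof.
move=> inj_f vf; rewrite -(@Pr_pattern _ _ _ _ _ (fun j => edge v (f j))).
  apply: eq_Pr => g; apply: eq_forallb => j; case: (boolP (P j)) => // /vf vj.
  by rewrite /adjg vj.
by move=> i j _ _ /edge_eq[[_ /inj_f]//|[e1 e2]]; apply: inj_f; rewrite e2.
Qed.

End Neighbourhoods.

(** * Union bound for nonexistence *)

Section UpperBound.
Variables (R : realFieldType) (p : R) (n : nat).
Hypotheses (p_le1 : p <= 1) (q_le_p : 1 - p <= p).
Local Notation V := 'I_n.
Local Notation q := (1 - p).

Let p_ge0 : 0 <= p. Proof. by move: p_le1 q_le_p; lra. Qed.
Let q_ge0 : 0 <= q. Proof. by move: p_le1; lra. Qed.
Let q_le1 : q <= 1. Proof. by move: p_ge0; lra. Qed.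

(** Here [q <= p] enters: whatever value is prescribed for a coin, it has probability at least
    [q]. *)
Lemma coin_geq b : q <= coin p b.
Proof. by case: b. Qed.

Lemma prod_lt_ord s (j : 'I_s) (x : R) : \prod_(i < s | (i < j)%N) x = x ^+ j.
Proof. by rewrite (big_ord_narrow (ltnW (ltn_ord j))) prodr_const card_ord. Qed.

(** Each pair is charged to its larger index, so the stars are disjoint and the star of [j]
    contributes [q ^+ j]. *)
Lemma Pr_independent s (f : {ffun 'I_s -> V}) : injective f ->
  Pr p (fun g => [forall j : 'I_s, [forall (i : 'I_s | (i < j)%N), adjg g (f j) (f i) == false]]) =
  q ^+ 'C(s, 2).
Proof.
move=> inj_f.
rewrite (@Pr_indep _ _ _ _ predT (fun j : 'I_s => star (f j) f (fun i : 'I_s => (i < j)%N)) 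
  (fun j g => [forall (i : 'I_s | (i < j)%N), adjg g (f j) (f i) == false])).
- rewrite (eq_bigr (fun j : 'I_s => q ^+ j)) => [|j _].
    by rewrite prodrXr -bin2_sum big_mkord.
  rewrite Pr_star ?prod_lt_ord // => i ij.
  by apply: contraTneq ij => /inj_f ->; rewrite ltnn.
- move=> j _; apply: depends_star => g g' gg'; apply: eq_forallb => i.
  by case: (boolP (i < j)%N) => // /gg' ->.
- move=> j j' _ _ jj'; apply: star_disjoint => i i' ij ij'.
  move/edge_eq => [[/inj_f jj _]|[/inj_f e1 /inj_f e2]]; first by rewrite jj eqxx in jj'.
  by move: ij ij'; rewrite e1 e2; lia.
Qed.

(** Distinct vertices outside the family read disjoint stars, and each realizes [h] with probability
    at least [q ^+ K]. *)
Lemma Pr_unrealized K (f : {ffun 'I_K -> V}) (h : {ffun 'I_K -> bool}) : injective f ->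
  Pr p (fun g => [forall (v | v \notin codom f), ~~ [forall j, adjg g v (f j) == h j]])
  <= (1 - q ^+ K) ^+ (n - K).
Proof.
move=> inj_f.
rewrite (@Pr_indep _ _ _ _ _ (fun v => star v f predT)
  (fun v g => ~~ [forall j, adjg g v (f j) == h j])).
- apply: (@le_trans _ _ (\prod_(v | v \notin codom f) (1 - q ^+ K))).
    apply: ler_prod => v vf; rewrite Pr_ge0 //= Pr_compl lerD2l lerN2.
    rewrite (@Pr_star _ _ _ _ _ _ predT) // => [|j _]; last by apply: contraNneq vf => ->; apply: codom_f.
    rewrite -[X in _ ^+ X]card_ord -prodr_const.
    by apply: ler_prod => j _; rewrite q_ge0 coin_geq.
  rewrite prodr_const le_eqVlt; apply/orP; left; apply/eqP; congr (_ ^+ _).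
  rewrite -[X in (X - _)%N]card_ord -[X in (_ - X)%N]card_ord -(card_codom inj_f).
  by rewrite -(cardC (mem (codom f))) addKn; apply: eq_card.
- move=> v _; apply: depends_star => g g' gg'; congr (~~ _).
  by apply: eq_forallb => j; rewrite gg'.
- move=> v v' vf v'f vv'; apply: star_disjoint => j j' _ _.
  move/edge_eq => [[e _]|[e _]]; first by rewrite e eqxx in vv'.
  by move: vf; rewrite e codom_f.
Qed.

(** Union bound over the failures of the hypotheses of [no_good]: an independent family, among at
    most [n ^ s], or a prescription [(f, h)] that no outside vertex realizes, among at most
    [(2n) ^ K]. *)
Lemma good_upper_bound t (F : pred {ffun V * V -> bool}) :
    (0 < t)%N -> (4 ^ t + t.*2 <= n)%N ->
    (forall g, F g -> exists a c, good (adjg g) a c) ->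
  Pr p F <= n%:R ^+ (4 ^ t.+1) * q ^+ 'C(4 ^ t.+1, 2) +
    (2 * n%:R) ^+ (4 ^ t + t.*2) * (1 - q ^+ (4 ^ t + t.*2)) ^+ (n - (4 ^ t + t.*2)).
Proof.
move=> t_gt0; set s := (4 ^ t.+1)%N; set K := (4 ^ t + t.*2)%N => leKn Fgood.
pose G (i : {ffun 'I_s -> V} + {ffun 'I_K -> V} * {ffun 'I_K -> bool}) : pred {ffun V * V -> bool} :=
  match i with
  | inl f => fun g => injectiveb f &&
      [forall j : 'I_s, [forall (i : 'I_s | (i < j)%N), adjg g (f j) (f i) == false]]
  | inr (f, h) => fun g => injectiveb f &&
      [forall (v | v \notin codom f), ~~ [forall j, adjg g v (f j) == h j]]
  end.
apply: (@le_trans _ _ (\sum_i Pr p (G i))).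
  apply: Pr_union => // g /Fgood [a [c gd]].
  have [/existsP[i Gi]|] := boolP [exists i, G i g]; first by exists i.
  rewrite negb_exists => /forallP noG; exfalso; move: gd.
  apply: (@no_good n (adjg g) t) => //.
  - by move=> x y; rewrite adjgC.
  - by move=> x; rewrite adjgxx.
  - move=> f inj_f; have := noG (inl f); rewrite /= (introT (injectiveP f) inj_f) /=.
    rewrite negb_forall => /existsP[j]; rewrite negb_forall_in => /exists_inP[i ij].
    by rewrite eqbF_neg negbK => rij; exists j, i; rewrite ij.
  - move=> f h inj_f; have := noG (inr (f, h)); rewrite /= (introT (injectiveP f) inj_f) /=.
    rewrite negb_forall_in => /exists_inP[v vf]; rewrite negbK => /forallP H.
    by exists v; split=> // j; apply/eqP.
have Pr0 (F' : pred {ffun V * V -> bool}) : (forall g, F' g = false) -> Pr p F' = 0.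
  by move=> F0; rewrite /Pr big_pred0.
rewrite big_sumType /=; apply: lerD.
  apply: (@le_trans _ _ (\sum_(f : {ffun 'I_s -> V}) q ^+ 'C(s, 2))).
    apply: ler_sum => f _; case: (injectiveP f) => [inj_f|_] /=.
      by rewrite Pr_independent.
    by rewrite Pr0 // exprn_ge0.
  by rewrite sumr_const card_ffun !card_ord -[X in X <= _]mulr_natl natrX.
apply: (@le_trans _ _ (\sum_(x : {ffun 'I_K -> V} * {ffun 'I_K -> bool})
   (1 - q ^+ K) ^+ (n - K))).
  apply: ler_sum => -[f h] _ /=; case: (injectiveP f) => [inj_f|_] /=.
    exact: Pr_unrealized.
  by rewrite Pr0 // exprn_ge0 // subr_ge0 exprn_ile1.
rewrite sumr_const card_prod !card_ffun !card_ord card_bool -[X in X <= _]mulr_natl.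
by rewrite natrM !natrX exprMn [X in _ <= X * _]mulrC.
Qed.

End UpperBound.

(** * Greedy search *)

(* The summand at [x] is the weight of the event that [x] is the first success in [B]. *)
Lemma first_success_sum (R : realFieldType) n (B : {set 'I_n}) (al de pi : R) :
    0 <= al -> 0 <= de -> al - de <= pi ->
  al ^+ #|B| - de ^+ #|B| <=
  \sum_(x in B) \prod_(v in B) (if v == x then pi else if (v < x)%N then de else al).
Proof.
move=> al0 de0 lepi; move cB: #|B| => N; elim: N B cB => [|N IH] B cB.
  by rewrite (cards0_eq cB) big_set0 !expr0 subrr.
have [x0 x0B] : exists x, x \in B by apply/card_gt0P; rewrite cB.
(* Peel off the largest element: its own summand is [pi * de ^+ N], and every other summand gains a
   factor [al]. The resulting lower bounds telescope. *)
pose m := [arg max_(x > x0 in B) (x : nat)].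
have [mB mmax] : m \in B /\ forall x, x \in B -> (x <= m)%N.
  by rewrite /m; case: arg_maxnP.
have cBm : #|B :\ m| = N by move: cB; rewrite (cardsD1 m) mB => -[].
rewrite (big_setD1 m mB) /=.
have -> : \prod_(v in B) (if v == m then pi else if (v < m)%N then de else al) =
          pi * de ^+ N.
  rewrite (big_setD1 m mB) /= eqxx; congr (_ * _).
  rewrite (eq_bigr (fun=> de)) ?prodr_const ?cBm // => v; rewrite in_setD1.
  case/andP=> vm vB; rewrite (negbTE vm) ltn_neqAle mmax // andbT.
  by rewrite ifT.
have -> : \sum_(x in B :\ m)
     \prod_(v in B) (if v == x then pi else if (v < x)%N then de else al) =
   al * \sum_(x in B :\ m) \prod_(v in B :\ m)
     (if v == x then pi else if (v < x)%N then de else al).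
  rewrite mulr_sumr; apply: eq_bigr => x; rewrite in_setD1 => /andP[xm xB].
  rewrite (big_setD1 m mB) /= eq_sym (negbTE xm) ltnNge mmax //.
have := ler_wpM2l al0 (IH _ cBm); rewrite mulrBr -exprS.
have := ler_wpM2r (exprn_ge0 N de0) lepi; rewrite mulrBl -exprS.
lra.
Qed.

Section Greedy.
Variables (R : realFieldType) (p : R) (n k : nat) (H : rel 'I_k) (bl : 'I_n -> 'I_k).
Hypotheses (p_le1 : p <= 1) (q_le_p : 1 - p <= p).
Hypotheses (HC : symmetric H) (Hxx : irreflexive H).
Local Notation V := 'I_n.
Local Notation q := (1 - p).
Implicit Types (g : {ffun V * V -> bool}) (v : V) (f : {ffun 'I_k -> V}).

Let p_ge0 : 0 <= p. Proof. by move: p_le1 q_le_p; lra. Qed.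
Let q_ge0 : 0 <= q. Proof. by move: p_le1; lra. Qed.
Let q_le1 : q <= 1. Proof. by move: p_ge0; lra. Qed.

Definition dominating_copy g f : bool :=
  [&& injectiveb f, [forall i, [forall j, adjg g (f i) (f j) == H i j]] &
      [forall v, (v \in codom f) || [exists j, adjg g v (f j)]]].

Definition matches f v g : bool :=
  [forall (j : 'I_k | (j < bl v)%N), adjg g v (f j) == H (bl v) j].

(* [f] is the output of the greedy search: [f i] is the first vertex of block
   [i] that is correctly joined to [f 0, ..., f (i - 1)]. *)
Definition greedy_at f v g : bool :=
  if v == f (bl v) then matches f v g
  else ~~ [forall j, adjg g v (f j) == false] && ((v < f (bl v))%N ==> ~~ matches f v g).

(** For a vertex outside the copy, [al] is the probability of having a neighbour in it, and [pi i]
    that of matching row [i] of [H]. By the union bound [de i] is a lower bound for having a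
    neighbour without matching. *)
Let al : R := 1 - q ^+ k.
Let pi (i : 'I_k) : R := \prod_(j < k | (j < i)%N) coin p (H i j).
Let de (i : 'I_k) : R := Num.max 0 (al - pi i).

Let al_ge0 : 0 <= al. Proof. by rewrite subr_ge0 exprn_ile1. Qed.
Let de_ge0 i : 0 <= de i. Proof. by rewrite /de le_max lexx. Qed.

Lemma pi_ge (i : 'I_k) : q ^+ i <= pi i.
Proof.
by rewrite -prod_lt_ord; apply: ler_prod => j _; rewrite q_ge0 coin_geq.
Qed.

(** The condition at a vertex of the copy fixes its adjacency to the earlier ones, and symmetry
    supplies the rest. The conditions at all other vertices give domination. *)
Lemma greedy_dominating_copy f g : (forall i, bl (f i) = i) ->
  [forall v, greedy_at f v g] -> dominating_copy g f.
Proof.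
move=> blf /forallP gr; have inj_f : injective f by apply: can_inj blf.
have lt_adj (i j : 'I_k) : (j < i)%N -> adjg g (f i) (f j) = H i j.
  have := gr (f i); rewrite /greedy_at /matches blf eqxx => /forall_inP/(_ j) E.
  by move=> /E/eqP.
apply/and3P; split; first exact/injectiveP.
  apply/forallP => i; apply/forallP => j; apply/eqP.
  case: (ltngtP i j) => [ij|ij|/val_inj ->]; last by rewrite adjgxx Hxx.
    by rewrite adjgC HC lt_adj.
  by rewrite lt_adj.
apply/forallP => v; have := gr v; rewrite /greedy_at; case: eqP => [-> _|_ /andP[]].
  by rewrite codom_f.
by rewrite negb_forall => /existsP[j]; rewrite eqbF_neg negbK => vj _;
   apply/orP; right; apply/existsP; exists j.
Qed.

(** Strong induction on [i]: if the choices agree before [i] and one family picks a smaller vertex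
    in block [i], that vertex matches, yet the other family demands that it should not. *)
Lemma greedy_unique f f' g : (forall i, bl (f i) = i) -> (forall i, bl (f' i) = i) ->
  [forall v, greedy_at f v g] -> [forall v, greedy_at f' v g] -> f = f'.
Proof.
move=> blf blf' gr gr'; apply/ffunP => i.
have [m] := ubnP (i : nat); elim: m i => // m IH i im.
have same f1 f2 : (forall i, bl (f1 i) = i) -> (forall i, bl (f2 i) = i) ->
    [forall v, greedy_at f1 v g] -> [forall v, greedy_at f2 v g] ->
    (forall j : 'I_k, (j < i)%N -> f1 j = f2 j) -> ~~ (f1 i < f2 i)%N.
  move=> b1 b2 /forallP/(_ (f1 i)) g1 /forallP/(_ (f1 i)) g2 e12.
  apply/negP => lt12; move: g1 g2; rewrite /greedy_at !b1 eqxx => m1.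
  case: eqP => [e|_]; first by rewrite e ltnn in lt12.
  rewrite lt12 /= => /andP[_ /negP]; apply; apply/forall_inP => j.
  by rewrite b1 => ji; rewrite -e12 //; move/forall_inP: m1 => /(_ j); rewrite b1; apply.
have e12 (j : 'I_k) : (j < i)%N -> f j = f' j by move=> ji; apply: IH; lia.
apply/val_inj/eqP; rewrite eqn_leq (leqNgt (f i)) (leqNgt (f' i)); apply/andP; split.
  by apply: (same f' f) => // j /e12.
by apply: (same f f').
Qed.

Lemma Pr_greedy f : (forall i, bl (f i) = i) ->
  \prod_v (if v == f (bl v) then pi (bl v) else
           if (v < f (bl v))%N then de (bl v) else al) <=
  Pr p (fun g => [forall v, greedy_at f v g]).
Proof.
move=> blf; have inj_f : injective f by apply: can_inj blf.
(* A vertex of the copy reads only its edges to earlier ones, any other vertex all its edges to the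
   copy; hence no coin is read by two vertices. *)
rewrite (@Pr_indep _ _ _ _ predT
  (fun v => star v f (fun j : 'I_k => (v == f (bl v)) ==> (j < bl v)%N)) (greedy_at f)).
- apply: ler_prod => v _; rewrite /greedy_at.
  have Pm : (forall j : 'I_k, (j < bl v)%N -> v != f j) -> Pr p (matches f v) = pi (bl v).
    by move=> vf; rewrite Pr_star.
  case: (eqVneq v (f (bl v))) => [ev|nev].
    rewrite (le_trans _ (pi_ge _)) ?exprn_ge0 //= Pm // => j; rewrite ev blf.
    by apply: contraTneq => /inj_f ->; rewrite ltnn.
  have vf j : v != f j by apply: contraNneq nev => ->; rewrite blf.
  have Piso : Pr p (fun g => [forall j, adjg g v (f j) == false]) = q ^+ k.
    by rewrite (@Pr_star _ _ _ _ _ _ predT) //= prodr_const card_ord.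
  case: ifP => /= [_|_]; last first.
    rewrite al_ge0 /=; under eq_Pr do rewrite andbT.
    by rewrite Pr_compl // Piso.
  rewrite de_ge0 /de ge_max Pr_ge0 //=.
  have <- : Pr p (fun g => ~~ ([forall j, adjg g v (f j) == false] || matches f v g)) =
    Pr p (fun g => ~~ [forall j, adjg g v (f j) == false] && ~~ matches f v g).
    by apply: eq_Pr => g; rewrite negb_or.
  rewrite Pr_compl // -addrA lerD2l -opprD lerN2 -Piso -Pm //.
  have := @Pr_union _ _ _ p_ge0 p_le1 bool
    (fun g => [forall j, adjg g v (f j) == false] || matches f v g)
    (fun b => if b then fun g => [forall j, adjg g v (f j) == false] else matches f v).
  rewrite big_bool; apply=> g /orP[]; first by exists true.
  by exists false.
- move=> v _; apply: depends_star => g g' gg'; rewrite /greedy_at /matches.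
  have -> : [forall (j : 'I_k | (j < bl v)%N), adjg g v (f j) == H (bl v) j] =
            [forall (j : 'I_k | (j < bl v)%N), adjg g' v (f j) == H (bl v) j].
    by apply: eq_forallb => j; case: (boolP (j < bl v)%N) => // jv; rewrite gg' ?jv ?implybT.
  case: ifP => // ev; congr (~~ _ && _); apply: eq_forallb => j.
  by rewrite gg' // ev.
- move=> v v' _ _ vv'; apply: star_disjoint => j j' /implyP vj /implyP vj'.
  case/edge_eq => [[e _]|[e e']]; first by rewrite e eqxx in vv'.
  have b1 : bl v = j' by rewrite e blf.
  have b2 : bl v' = j by rewrite -e' blf.
  move: vj vj'; rewrite b1 b2 -e e' !eqxx => /(_ isT) + /(_ isT); lia.
Qed.

(** The events for different [f] are disjoint by [greedy_unique]. Choosing [f] means choosing one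
    vertex per block, so the sum of products is a product over blocks of the sums estimated by
    [first_success_sum]. *)
Lemma greedy_lower_bound :
  al ^+ n * \prod_(i < k) (1 - (1 - q ^+ i) ^+ #|[set v | bl v == i]|) <=
  Pr p (fun g => [exists f, dominating_copy g f]).
Proof.
pose Fam f := [forall i, bl (f i) == i].
apply: (@le_trans _ _ (\sum_(f | Fam f) Pr p (fun g => [forall v, greedy_at f v g]))); last first.
  apply: Pr_disjoint => // [f g /forallP fam gr|f f' g /forallP fam /forallP fam'].
    by apply/existsP; exists f; apply: greedy_dominating_copy => // i; apply/eqP.
  by apply: greedy_unique => i; apply/eqP.
apply: (@le_trans _ _ (\sum_(f | Fam f) \prod_v (if v == f (bl v) then pi (bl v) else
           if (v < f (bl v))%N then de (bl v) else al))); last first.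
  by apply: ler_sum => f /forallP fam; apply: Pr_greedy => i; apply/eqP.
pose W i x : R := \prod_(v in [set v | bl v == i])
  (if v == x then pi i else if (v < x)%N then de i else al).
have -> : \sum_(f | Fam f) \prod_v (if v == f (bl v) then pi (bl v) else
           if (v < f (bl v))%N then de (bl v) else al) =
    \prod_i \sum_(x in [set v | bl v == i]) W i x.
  rewrite bigA_distr_big_dep; apply: eq_big => [f|f _].
    by apply: eq_forallb => i; rewrite inE.
  rewrite (partition_big bl predT) //=; apply: eq_bigr => i _.
  rewrite /W; apply: eq_big => [v|v /eqP <-//]; by rewrite inE.
have -> : al ^+ n = \prod_(i < k) al ^+ #|[set v | bl v == i]|.
  rewrite prodrXr; congr (_ ^+ _).
  rewrite -[LHS]card_ord -sum1_card (partition_big bl predT) //=.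
  by apply: eq_bigr => i _; rewrite -sum1_card; apply: eq_bigl => v; rewrite inE.
rewrite -big_split /=; apply: ler_prod => i _.
set N := #|_|; have qi0 : 0 <= q ^+ i by rewrite exprn_ge0.
have qi1 : q ^+ i <= 1 by rewrite exprn_ile1.
rewrite mulr_ge0 ?exprn_ge0 ?subr_ge0 ?exprn_ile1 //=; [|lra..].
apply: le_trans (first_success_sum _ al_ge0 (de_ge0 i) _); last first.
  by rewrite /de; have := le_max (al - pi i) 0 (al - pi i); rewrite lexx orbT; lra.
(* It remains to see that [de i <= al * (1 - q ^+ i)], which holds because [al <= 1] and
   [q ^+ i <= pi i]. *)
rewrite mulrBr mulr1 lerD2l lerN2 -exprMn; apply: lerXn2r; rewrite ?nnegrE ?de_ge0 //.
  by rewrite mulr_ge0 //; lra.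
rewrite /de ge_max mulr_ge0 //=; last by lra.
have := pi_ge i; have : al <= 1 by rewrite /al lerBlDr lerDl exprn_ge0.
move: qi0; move: (q ^+ i) => y; nra.
Qed.

End Greedy.

(** * The pattern *)

Section Pattern.
Variable t : nat.

(** The left summand is [A], matched by flipping the boolean; the right one is [C], each of whose
    vertices is its own trace on [A]. *)
Definition pattern : finType := ((bool * 'I_t) + {set bool * 'I_t})%type.

Definition pattern_rel (x y : pattern) : bool :=
  match x, y with
  | inl a, inl b => (a.2 == b.2) && (a.1 != b.1)
  | inl a, inr X | inr X, inl a => a \in X
  | inr _, inr _ => false
  end.

Lemma pattern_relC : symmetric pattern_rel.
Proof. by move=> [a|X] [b|X'] //=; rewrite eq_sym [X in _ && ~~ X]eq_sym. Qed.

Lemma pattern_relxx : irreflexive pattern_rel.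
Proof. by move=> [a|X] //=; rewrite !eqxx. Qed.

Lemma card_pattern_gt : (t < #|pattern|)%N.
Proof.
have : (0 < #|{set bool * 'I_t}|)%N by apply/card_gt0P; exists set0.
by move=> h; rewrite card_sum card_prod card_bool card_ord -addn1 leq_add // leq_pmull.
Qed.

Variables (n : nat) (r : rel 'I_n) (f : pattern -> 'I_n).

Definition dominating_pattern : Prop :=
  [/\ injective f, forall x y, r (f x) (f y) = pattern_rel x y &
      forall v, v \in codom f \/ exists y, r v (f y)].

Hypothesis dom_f : dominating_pattern.

(** The predicates enter through reflection because the two sentences define the same sets by
    different formulas. *)
Lemma pattern_good (a c : 'I_n -> bool) :
    (forall v, reflect (exists x, v = f (inl x)) (a v)) ->
    (forall v, reflect (exists X, v = f (inr X)) (c v)) ->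
  good r a c.
Proof.
case: dom_f => inj_f rf dom aP cP.
have all_f x : a (f x) || c (f x).
  case: x => [x|X]; first by apply/orP; left; apply/aP; exists x.
  by apply/orP; right; apply/cP; exists X.
split.
- by move=> _ _ /cP[X ->] /cP[Y ->]; rewrite rf.
- move=> _ /aP[x ->]; exists (f (inl (~~ x.1, x.2))); split.
  + by apply/aP; exists (~~ x.1, x.2).
  + by rewrite rf /= eqxx; case: x.1.
  + move=> _ /aP[y ->]; rewrite rf /= => /andP[/eqP xy2 xy1]; congr (f (inl _)).
    by case: x y xy1 xy2 => [[] x] [[] y] //= _ ->.
- move=> _ _ /cP[X ->] /cP[Y ->] tr; congr (f (inr _)); apply/setP => x.
  by have := tr (f (inl x)); rewrite !rf; apply; apply/aP; exists x.
- move=> v; exists (f (inr [set x | r (f (inl x)) v])).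
    by apply/cP; exists [set x | r (f (inl x)) v].
  by move=> _ /aP[x ->]; rewrite rf /= inE.
- move=> v; case: (dom v) => [/codomP[x ->]|[y vy]]; first by left.
  by right; exists (f y).
Qed.

End Pattern.

Lemma pattern_phi1 t n pol (r : rel 'I_n) (f : pattern t -> 'I_n) :
  dominating_pattern (pol_rel pol r) f -> emso_holds r (phi1 pol).
Proof.
move=> dom; apply: (@good_phi1 _ _ _ [set f (inl x) | x : bool * 'I_t]
  [set f (inr X) | X : {set bool * 'I_t}]).
apply: (pattern_good dom) => v.
  by apply: (iffP imsetP) => [[x _]|[x]] ->; exists x.
by apply: (iffP imsetP) => [[x _]|[x]] ->; exists x.
Qed.

(** Take for [X] the whole copy and for [u] the vertex of [C] with full trace: it is adjacent to all
    of [A] and to nothing in [C]. *)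
Lemma pattern_phi2 t n pol (r : rel 'I_n) (f : pattern t -> 'I_n) :
  dominating_pattern (pol_rel pol r) f -> emso_holds r (phi2 pol).
Proof.
move=> dom; apply: (@good_phi2 _ _ _ [set f x | x : pattern t] (f (inr setT))).
have [_ rf _] := dom; apply: (pattern_good dom) => v.
  apply: (iffP andP) => [[/imsetP[[x|X] _ ->]]|[x ->]]; rewrite rf /= ?inE //.
    by exists x.
  by split=> //; apply: imset_f.
apply: (iffP andP) => [[/imsetP[[x|X] _ ->]]|[X ->]]; rewrite rf /= ?inE //.
  by exists X.
by split=> //; apply: imset_f.
Qed.

Lemma block_map k (N : 'I_k -> nat) :
  exists bl : 'I_(\sum_i N i) -> 'I_k, forall i, #|[set v | bl v == i]| = N i.
Proof.
pose T : finType := {i : 'I_k & 'I_(N i)}.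
have cT : (\sum_i N i)%N = #|T|.
  rewrite card_tagged sumnE big_map big_enum /=.
  by apply: eq_bigr => i _; rewrite card_ord.
exists (fun v => tag (enum_val (cast_ord cT v))) => i.
transitivity #|[set: 'I_(N i)]|; last by rewrite cardsT card_ord.
rewrite -[RHS](card_imset _ (f := fun j : 'I_(N i) => cast_ord (esym cT) (enum_rank (Tagged _ j : T)))).
  apply: eq_card => v; rewrite inE; apply/eqP/imsetP => [<-|[j _ ->]].
    exists (tagged (enum_val (cast_ord cT v))); first by rewrite inE.
    by apply: (@cast_ord_inj _ _ cT); rewrite cast_ordKV taggedK enum_valK.
  by rewrite cast_ordKV enum_rankK.
move=> j j' /cast_ord_inj/enum_rank_inj /eqP.
by rewrite eq_Tagged => /eqP.
Qed.

(** * Probability of a dominating copy of the pattern *)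

Section PatternProbability.
Variables (R : realFieldType) (p : R) (t n : nat) (bl : 'I_n -> 'I_#|pattern t|).
Hypotheses (p_le1 : p <= 1) (q_le_p : 1 - p <= p).

(** The search needs numbered vertices, so the pattern is transported along its enumeration. *)
Lemma pattern_lower_bound (M : nat -> nat) (F : pred {ffun 'I_n * 'I_n -> bool}) :
    (forall i, #|[set v | bl v == i]| = M i) ->
    (forall g (f : pattern t -> 'I_n), dominating_pattern (adjg g) f -> F g) ->
  (1 - (1 - p) ^+ #|pattern t|) ^+ n *
    \prod_(i < #|pattern t|) (1 - (1 - (1 - p) ^+ i) ^+ M i) <= Pr p F.
Proof.
move=> blM domF; under eq_bigr do rewrite -blM.
pose H (i j : 'I_#|pattern t|) := pattern_rel (enum_val i : pattern t) (enum_val j).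
have HC : symmetric H by move=> i j; apply: pattern_relC.
have Hxx : irreflexive H by move=> i; apply: pattern_relxx.
apply: le_trans (greedy_lower_bound bl p_le1 q_le_p HC Hxx) _.
apply: le_Pr => //; first by move: p_le1 q_le_p; lra.
move=> g /existsP[f /and3P[/injectiveP inj_f /forallP fH /forallP dom]].
apply: (domF g (fun x => f (enum_rank x))); split.
- by move=> x y /inj_f/enum_rank_inj.
- by move=> x y; have /forallP/(_ (enum_rank y))/eqP -> := fH (enum_rank x); rewrite /H !enum_rankK.
- move=> v; case/orP: (dom v) => [/codomP[i ->]|/existsP[j vj]].
    by left; apply/codomP; exists (enum_val i); rewrite enum_valK.
  by right; exists (enum_val j); rewrite enum_valK.
Qed.

End PatternProbability.

(** * Estimates *)

(** The cubic term is the exponent of a union bound, the right side the number of halvings that must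
    beat it, and the extra [m] the gain. *)
Lemma cube_le_exp m : (64 <= m)%N -> (40 * m * m * m + m <= 2 ^ (m - 2))%N.
Proof.
move=> m64; have -> : m = (64 + (m - 64))%N by rewrite subnKC.
elim: (m - 64)%N => [|d IH]; last first.
  have -> : (64 + d.+1 - 2 = (64 + d - 2).+1)%N by lia.
  rewrite expnS; move: IH; move: (2 ^ _)%N => x; rewrite addnS.
  have : (64 <= 64 + d)%N by lia.
  move: (64 + d)%N => y; nia.
rewrite addn0; have e : 64%N = (2 ^ 6)%N by [].
apply: (@leq_trans (64 * 64 * 64 * 64)); first by lia.
by rewrite {1 2 3 4}e -!expnD leq_pexp2l.
Qed.

Section Powers.
Variable R : realFieldType.
Implicit Types x y : R.

Lemma bernoulli y n : -1 <= y -> 1 + y * n%:R <= (1 + y) ^+ n.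
Proof.
move=> y1; elim: n => [|n IH]; first by rewrite mulr0 addr0 expr0.
rewrite exprS -natr1; have : 0 <= 1 + y by lra.
move/ler_wpM2l => /(_ _ _ IH); apply: le_trans.
by have := mulr_ge0 (sqr_ge0 y) (ler0n R n); nra.
Qed.

(** By Bernoulli [(1 + y) ^+ M] is at least 2, and its product with [(1 - y) ^+ M] is at most 1; so
    every [M] factors halve the power. *)
Lemma expr_le_half y M w N : 0 <= y <= 1 -> 1 <= y * M%:R -> (M * w <= N)%N ->
  (1 - y) ^+ N <= 2^-1 ^+ w.
Proof.
case/andP=> y0 y1 yM MwN.
apply: (@le_trans _ _ ((1 - y) ^+ (M * w))); first by rewrite ler_wiXn2l //; lra.
rewrite exprM; apply: lerXn2r; rewrite ?nnegrE ?exprn_ge0 ?invr_ge0 //; first by lra.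
have b : 1 + y * M%:R <= (1 + y) ^+ M by apply: bernoulli; lra.
have : (1 - y) ^+ M * (1 + y) ^+ M <= 1.
  by rewrite -exprMn exprn_ile1 //; nra.
have : 0 <= (1 - y) ^+ M by rewrite exprn_ge0 // subr_ge0.
move: b; move: ((1 - y) ^+ M) ((1 + y) ^+ M) => u v; nra.
Qed.

(** Cut the exponent into 24 blocks of length [m]. Bernoulli bounds each block below by [1 - y * m],
    where [y * m] is at most [6 / 24 + 1 / 2]. *)
Lemma expr_ge_quarter y n : 0 <= y <= 2^-1 -> y * n%:R <= 6 ->
  (4^-1) ^+ 24 <= (1 - y) ^+ n.
Proof.
case/andP=> y0 y2 yn; pose m := (n %/ 24).+1.
have le_n : (n <= m * 24)%N by rewrite /m; lia.
apply: (@le_trans _ _ ((1 - y) ^+ (m * 24))); last by rewrite ler_wiXn2l //; lra.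
rewrite exprM; apply: lerXn2r; rewrite ?nnegrE ?exprn_ge0 ?invr_ge0 //; first by lra.
apply: (le_trans _ (@bernoulli (- y) m _)); last by lra.
have : (n %/ 24)%:R * 24 <= n%:R :> R by rewrite -natrM ler_nat leq_divM.
move/(ler_wpM2l y0); rewrite /m -[(n %/ 24).+1%:R]natr1.
by move: (n%:R : R) ((n %/ 24)%:R : R) yn => u v; lra.
Qed.

Lemma prod_one_sub_ge k (x : nat -> R) : (forall i, 0 <= x i <= 1) ->
  1 - \sum_(i < k) x i <= \prod_(i < k) (1 - x i).
Proof.
move=> x01; elim: k => [|k IH]; first by rewrite !big_ord0 subr0.
rewrite !big_ord_recr /=; have /andP[xk0 xk1] := x01 k.
have s0 : 0 <= \sum_(i < k) x i by apply: sumr_ge0 => i _; case/andP: (x01 i).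
by move: IH s0; move: (\sum_(i < k) x i) (\prod_(i < k) _) => s P; nra.
Qed.

Lemma sum_half_pow k : \sum_(i < k) 2^-1 ^+ (k - i).+1 <= 2^-1 :> R.
Proof.
suff -> : \sum_(i < k) 2^-1 ^+ (k - i).+1 = 2^-1 - 2^-1 ^+ k.+1 :> R.
  by rewrite lerBlDr lerDl exprn_ge0 // invr_ge0.
elim: k => [|k IH]; first by rewrite big_ord0 expr1 subrr.
rewrite big_ord_recl /= subn0 IH [2^-1 ^+ k.+2]exprS; lra.
Qed.

Lemma sum_mul_half_pow k : \sum_(i < k) (k - i).+1%:R * 2^-1 ^+ (k - i) <= 3 :> R.
Proof.
suff -> : \sum_(i < k) (k - i).+1%:R * 2^-1 ^+ (k - i) = 3 - (k%:R + 3) * 2^-1 ^+ k :> R.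
  by rewrite lerBlDr lerDl mulr_ge0 ?addr_ge0 ?exprn_ge0 ?invr_ge0 ?ler0n.
elim: k => [|k IH]; first by rewrite big_ord0 expr0; lra.
rewrite big_ord_recl /= subn0 IH [2^-1 ^+ k.+1]exprS -[k.+2%:R]natr1 -[k.+1%:R]natr1.
by move: (2^-1 ^+ k) (k%:R : R) => u v; lra.
Qed.

End Powers.

(** * Sizes of the blocks and of the graphs *)

Section Ceil.
Variables (R : realType) (q : R).
Hypotheses (q_gt0 : 0 < q) (q_le : q <= 2^-1).

Definition qceil i : nat := (Num.truncn (q^-1 ^+ i)).+1.

Lemma qinv_ge2 : 2 <= q^-1.
Proof. by rewrite -[2]invrK lef_pV2 ?posrE ?invr_gt0. Qed.

Lemma two_exp_le_qinv i : 2 ^+ i <= q^-1 ^+ i.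
Proof. by apply: lerXn2r; rewrite ?nnegrE ?invr_ge0 ?(ltW q_gt0) ?qinv_ge2. Qed.

Lemma qceil_ge i : q^-1 ^+ i <= (qceil i)%:R.
Proof. exact/ltW/truncnS_gt. Qed.

Lemma qceil_le i : (qceil i)%:R <= 2 * q^-1 ^+ i.
Proof.
have q1 : 1 <= q^-1 ^+ i by apply: exprn_ege1; have := qinv_ge2; lra.
have /andP[+ _] : (Num.truncn (q^-1 ^+ i))%:R <= q^-1 ^+ i < (Num.truncn (q^-1 ^+ i)).+1%:R.
  by apply: truncn_itv; lra.
by rewrite /qceil -[_.+1%:R]natr1; lra.
Qed.

Lemma exprq_qinv i : q ^+ i * q^-1 ^+ i = 1.
Proof. by rewrite -exprMn mulfV ?gt_eqF // expr1n. Qed.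

Lemma exprq_qceil i : 1 <= q ^+ i * (qceil i)%:R.
Proof. by rewrite -[X in X <= _](exprq_qinv i) ler_pM2l ?exprn_gt0 // qceil_ge. Qed.

Let q_ge0 : 0 <= q. Proof. exact: ltW. Qed.
Let q_le1 : q <= 1. Proof. by move: q_le; lra. Qed.
Let q01 i : 0 <= q ^+ i <= 1.
Proof. by rewrite exprn_ge0 //= exprn_ile1. Qed.

(** The block sizes balance two demands: [q ^+ k] times their sum stays below 6, as the terms decay
    geometrically in [k - i], and block [i] fails with probability at most [2^-1 ^+ (k - i).+1],
    which sums to at most one half. *)
Lemma greedy_bound_ge k (N : nat -> nat) : (0 < k)%N ->
    (forall i, N i = (qceil i * (k - i).+1)%N) ->
  4^-1 ^+ 24 * 2^-1 <=
  (1 - q ^+ k) ^+ (\sum_(i < k) N i) * \prod_(i < k) (1 - (1 - q ^+ i) ^+ N i).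
Proof.
move=> k_gt0 NE; apply: ler_pM; rewrite ?exprn_ge0 ?invr_ge0 //.
  apply: expr_ge_quarter.
    case/andP: (q01 k) => -> _ /=; rewrite -(prednK k_gt0) exprS.
    by apply: le_trans q_le; apply: ler_piMr => //; case/andP: (q01 k.-1).
  rewrite natr_sum mulr_sumr.
  apply: (@le_trans _ _ (\sum_(i < k) 2 * ((k - i).+1%:R * 2^-1 ^+ (k - i)))).
    apply: ler_sum => i _; rewrite NE natrM.
    have -> : q ^+ k = q ^+ (k - i) * q ^+ i by rewrite -exprD subnK // ltnW.
    have h1 : q ^+ i * (qceil i)%:R <= 2.
      have := qceil_le i; rewrite -(ler_pM2l (exprn_gt0 i q_gt0)) mulrCA exprq_qinv mulr1.
      by [].
    have h2 : q ^+ (k - i) <= 2^-1 ^+ (k - i) by apply: lerXn2r; rewrite ?nnegrE ?invr_ge0.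
    have h3 : 0 <= q ^+ (k - i) by rewrite exprn_ge0.
    have h4 : 0 <= q ^+ i * (qceil i)%:R by rewrite mulr_ge0 ?exprn_ge0.
    apply: (@le_trans _ _ ((k - i).+1%:R * (q ^+ (k - i) * (q ^+ i * (qceil i)%:R)))).
      by rewrite le_eqVlt; apply/orP; left; apply/eqP; ring.
    rewrite [leRHS]mulrCA; apply: ler_wpM2l => //; rewrite [leRHS]mulrC.
    exact: ler_pM.
  rewrite -mulr_sumr; have := sum_mul_half_pow R k; lra.
apply: le_trans (@prod_one_sub_ge _ k (fun i => (1 - q ^+ i) ^+ N i) _); last first.
  move=> i; have /andP[h0 h1] := q01 i.
  by rewrite exprn_ge0 ?exprn_ile1 //; lra.
have : \sum_(i < k) (1 - q ^+ i) ^+ N i <= \sum_(i < k) 2^-1 ^+ (k - i).+1.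
  by apply: ler_sum => i _; apply: expr_le_half (exprq_qceil i) _; rewrite ?NE.
have := sum_half_pow R k; lra.
Qed.

(** Applied with [m = 4 ^ (t - 1)]. To base [q^-1], the logarithm of the order of the graph is about
    [6m]: independent sets reach about [12m < 16m], while sets of size [5m < 6m] are still
    shattered. *)
Lemma obstruction_bound_le l m K : q^-1 <= 2 ^+ l -> (l <= m)%N -> (64 <= m)%N -> (K <= 5 * m)%N ->
  (qceil (6 * m))%:R ^+ (16 * m) * q ^+ 'C(16 * m, 2) +
    (2 * (qceil (6 * m))%:R) ^+ K * (1 - q ^+ K) ^+ (qceil (6 * m) - K)
  <= 2 * 2^-1 ^+ m.
Proof.
move=> ql lm m64 Km; set n := qceil (6 * m).
have qV0 : 0 <= q^-1 by rewrite invr_ge0.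
have qV1 : 1 <= q^-1 by have := qinv_ge2; lra.
have n_ge : q^-1 ^+ (6 * m) <= n%:R := qceil_ge _.
have n_le : n%:R <= q^-1 ^+ (6 * m).+1.
  apply: le_trans (qceil_le _) _; rewrite exprS; apply: ler_wpM2r qinv_ge2.
  by rewrite exprn_ge0.
have n2_le : 2 * n%:R <= q^-1 ^+ (6 * m).+2.
  by rewrite exprS; apply: ler_pM => //; apply: qinv_ge2.
rewrite [leRHS]mulr_natl [leRHS]mulr2n; apply: lerD.
  have h : ((6 * m).+1 * (16 * m) + m <= 'C(16 * m, 2))%N.
    by rewrite bin2; nia.
  apply: (@le_trans _ _ (q^-1 ^+ ((6 * m).+1 * (16 * m)) * q ^+ ((6 * m).+1 * (16 * m) + m))).
    apply: ler_pM; rewrite ?exprn_ge0 //.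
      by rewrite [leRHS]exprM; apply: lerXn2r; rewrite ?nnegrE ?exprn_ge0.
    by apply: ler_wiXn2l.
  rewrite exprD mulrA [X in X * _]mulrC exprq_qinv mul1r.
  by apply: lerXn2r; rewrite ?nnegrE ?invr_ge0.
(* Since [4 * w <= q^-1 ^+ m], the product [qceil (5 * m) * w] takes at most half of
   [q^-1 ^+ (6 * m)]: one factor 2 absorbs the rounding in [qceil], the other leaves room for the
   [5 * m] excluded vertices. *)
pose w := (2 ^ (m - 2))%N.
have hw : (40 * m * m * m + m <= w)%N.
  exact: cube_le_exp.
have h1 : (1 - q ^+ K) ^+ (n - K) <= 2^-1 ^+ w.
  apply: (@le_trans _ _ ((1 - q ^+ (5 * m)) ^+ (n - K))).
    have /andP[_ ?] := q01 K; have /andP[_ ?] := q01 (5 * m).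
    apply: lerXn2r; rewrite ?nnegrE ?subr_ge0 // lerD2l lerN2.
    by apply: ler_wiXn2l.
  apply: expr_le_half (exprq_qceil (5 * m)) _ => //.
  have h5m : (5 * m <= 2 ^ (6 * m).-1)%N.
    apply: (@leq_trans (2 ^ (m - 2) * 4)); first by move: hw; rewrite /w; nia.
    by rewrite -(expnD 2 _ 2) leq_pexp2l //; lia.
  suff : (qceil (5 * m) * w + 5 * m <= n)%N by lia.
  rewrite -(ler_nat R) natrD; apply: le_trans n_ge.
  have -> : q^-1 ^+ (6 * m) = q^-1 ^+ m * q^-1 ^+ (5 * m) by rewrite -exprD -mulSn.
  have c1 := qceil_le (5 * m).
  have c2 : (4 * w)%:R <= q^-1 ^+ m.
    apply: le_trans (two_exp_le_qinv m); rewrite -natrX ler_nat.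
    by rewrite /w -(expnD 2 2) leq_pexp2l //; lia.
  have c3 : 2 * (5 * m)%:R <= q^-1 ^+ m * q^-1 ^+ (5 * m).
    rewrite -exprD -mulSn; apply: le_trans (two_exp_le_qinv _).
    rewrite -natrX -natrM ler_nat; apply: (@leq_trans (2 * 2 ^ (6 * m).-1)).
      by rewrite leq_mul2l.
    by rewrite -expnS leq_pexp2l //; lia.
  have c4 : 0 <= w%:R :> R by [].
  have c5 : 0 <= q^-1 ^+ (5 * m) by rewrite exprn_ge0.
  rewrite natrM; move: c1 c2 c3 c4 c5; rewrite natrM.
  move: (q^-1 ^+ m) (q^-1 ^+ (5 * m)) (w%:R : R) ((qceil (5 * m))%:R : R) ((5 * m)%:R : R).
  move=> x y z u v c1 c2 c3 c4 c5.
  have : u * z <= 2 * y * z by apply: ler_wpM2r.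
  have : 4 * z * y <= x * y by apply: ler_wpM2r.
  lra.
(* The constant is [8 * 5]: [l * (6 * m).+2 <= m * (8 * m)] and [K <= 5 * m]. *)
have h2 : (2 * n%:R) ^+ K <= 2 ^+ (40 * m * m * m) :> R.
  apply: (@le_trans _ _ ((2 ^+ (l * (6 * m).+2)) ^+ K)).
    apply: lerXn2r; rewrite ?nnegrE ?exprn_ge0 ?mulr_ge0 //.
    apply: le_trans n2_le _; rewrite [leRHS]exprM; apply: lerXn2r => //.
    by rewrite nnegrE exprn_ge0.
  rewrite -exprM; apply: ler_weXn2l; first by lra.
  apply: (@leq_trans (m * (8 * m) * (5 * m))); last by nia.
  by apply: leq_mul => //; apply: leq_mul => //; lia.
apply: (@le_trans _ _ (2 ^+ (40 * m * m * m) * 2^-1 ^+ (40 * m * m * m + m))).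
  apply: ler_pM => //.
  - by rewrite exprn_ge0 // mulr_ge0.
  - by have /andP[_ ?] := q01 K; rewrite exprn_ge0 // subr_ge0.
  - by apply: le_trans h1 _; apply: ler_wiXn2l => //; lra.
by rewrite exprD mulrA -exprMn mulfV ?expr1n ?mul1r // pnatr_eq0.
Qed.

End Ceil.

(** * Non-convergence *)

(** The coins [g] now describe the graph that the polarized relation sees; for [pol = false] the
    actual graph is its complement. *)
Lemma prob_Gnp_pol (R : realType) (p : R) n s (pol : bool) :
  prob_Gnp n p s = Pr (if pol then p else 1 - p)
    (fun g : {ffun 'I_n * 'I_n -> bool} => emso_holds (adjg (if pol then g else [ffun e => ~~ g e])) s).
Proof.
rewrite prob_GnpE; case: pol => //.
rewrite (Pr_neg (1 - p) (fun g : {ffun 'I_n * 'I_n -> bool} => emso_holds (adjg g) s)).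
by rewrite subKr.
Qed.

Lemma pol_rel_flip n (pol : bool) (g : {ffun 'I_n * 'I_n -> bool}) :
  pol_rel pol (adjg (if pol then g else [ffun e => ~~ g e])) =2 adjg g.
Proof.
move=> x y; rewrite pol_relE; case: pol => //; congr (adjg _ x y).
by apply/ffunP => e; rewrite !ffunE negbK.
Qed.

Section NonConvergence.
Variables (R : realType) (p : R) (pol : bool) (phi : emso).
Local Notation p' := (if pol then p else 1 - p).
Local Notation q := (1 - p').
Hypotheses (q_gt0 : 0 < q) (q_le_half : q <= 2^-1).
Hypothesis phi_good : forall n (r : rel 'I_n),
  emso_holds r phi -> exists a c, good (pol_rel pol r) a c.
Hypothesis pattern_phi : forall t n (r : rel 'I_n) (f : pattern t -> 'I_n),
  dominating_pattern (pol_rel pol r) f -> emso_holds r phi.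

Let p'_le1 : p' <= 1. Proof. by move: q_gt0; lra. Qed.
Let q_le_p' : q <= p'. Proof. by move: q_le_half; lra. Qed.

Lemma prob_often_large N : exists2 n, (N <= n)%N & 4^-1 ^+ 24 * 2^-1 <= prob_Gnp n p phi.
Proof.
pose k := #|pattern N|; pose M i := (qceil q i * (k - i).+1)%N.
have Nk : (N < k)%N := card_pattern_gt N.
exists (\sum_(i < k) M i)%N.
  apply: leq_trans (ltnW Nk) _; rewrite -[leqLHS]card_ord -sum1_card.
  by apply: leq_sum => i _; rewrite muln_gt0.
have [bl blM] := block_map (fun i : 'I_k => M i).
apply: le_trans (@greedy_bound_ge _ _ q_gt0 q_le_half k M _ _) _ => //.
  exact: leq_ltn_trans Nk.
rewrite (prob_Gnp_pol _ _ _ pol).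
apply: (pattern_lower_bound _ _ blM) => // g f domf; apply: (@pattern_phi N _ _ f).
case: domf => inj_f rf dom; split=> // [x y|v]; first by rewrite pol_rel_flip.
by case: (dom v) => [|[y vy]]; [left|right; exists y; rewrite pol_rel_flip].
Qed.

Lemma prob_often_small N (eps : R) : 0 < eps ->
  exists2 n, (N <= n)%N & prob_Gnp n p phi < eps.
Proof.
move=> eps0; pose l := Num.bound (q^-1); pose l' := Num.bound (2 * eps^-1).
(* The summand 3 gives [m >= 64], and [N], [l], [l'] make [m] large against the required order,
   [q^-1] and [2 / eps]. The obstruction is used with [t = u.+1]. *)
pose u := (3 + N + l + l')%N; pose m := (4 ^ u)%N.
have um : (u < m)%N by apply: ltn_expl.
have leu x : (x <= u)%N -> (x <= m)%N by move=> xu; apply: leq_trans xu (ltnW um).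
have [Nm lm l'm] : [/\ (N <= m)%N, (l <= m)%N & (l' <= m)%N].
  by split; apply: leu; rewrite /u; lia.
have m64 : (64 <= m)%N by rewrite /m /u -!addnA expnD leq_pmulr // expn_gt0.
have um2 : (u.+1.*2 <= m)%N.
  have -> : m = (4 * 4 ^ u.-1)%N by rewrite -expnS prednK.
  have : (u.-1 < 4 ^ u.-1)%N by apply: ltn_expl.
  by rewrite -muln2 /u; lia.
pose K := (4 ^ u.+1 + u.+1.*2)%N.
have Km : (K <= 5 * m)%N by rewrite /K expnS -/m; lia.
have ql : q^-1 <= 2 ^+ l by apply/ltW/upper_nthrootP.
have small := obstruction_bound_le q_gt0 q_le_half ql lm m64 Km.
have n_ge : (2 ^ (6 * m) <= qceil q (6 * m))%N.
  rewrite -(ler_nat R) natrX; apply: le_trans (qceil_ge _ _).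
  exact: two_exp_le_qinv.
have n_ge6 : (6 * m <= qceil q (6 * m))%N.
  by apply: leq_trans n_ge; apply/ltnW/ltn_expl.
exists (qceil q (6 * m)).
  by apply: leq_trans n_ge6; apply: leq_trans Nm (leq_pmull _ _).
rewrite (prob_Gnp_pol _ _ _ pol).
apply: (@le_lt_trans _ _ (2 * 2^-1 ^+ m)).
  have e16 : (4 ^ u.+2 = 16 * m)%N by rewrite (expnS 4 u.+1) (expnS 4 u) mulnA.
  apply: le_trans small.
  rewrite -e16; apply: good_upper_bound => //.
    by apply: leq_trans Km _; apply: leq_trans n_ge6; rewrite leq_mul2r orbT.
  move=> g /phi_good [a [c gd]]; exists a, c.
  by apply: eq_good gd; apply: pol_rel_flip.
have h : 2 * eps^-1 < 2 ^+ m.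
  exact: upper_nthrootP.
rewrite exprVn ltr_pdivrMr ?exprn_gt0 //.
by move: h; rewrite ltr_pdivrMr // mulrC.
Qed.

(** Values at least [c] and values below [c / 3] both recur, and their gap exceeds the [2c / 3] that
    a limit with tolerance [c / 3] allows. *)
Lemma not_converges_prob : ~ converges (fun n => prob_Gnp n p phi).
Proof.
case=> l lim; pose c : R := 4^-1 ^+ 24 * 2^-1.
have c0 : 0 < c by rewrite mulr_gt0 ?exprn_gt0 ?invr_gt0.
have [N HN] := lim (c / 3) (divr_gt0 c0 (ltr0n _ 3)).
have [n1 /HN l1 b1] := prob_often_large N.
have [n2 /HN l2 b2] := prob_often_small N (divr_gt0 c0 (ltr0n _ 3)).
move: l1 l2; rewrite !ltr_norml => /andP[_ h1] /andP[h2 _].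
by move: b1 b2 h1 h2; rewrite -/c; lra.
Qed.

End NonConvergence.

Theorem theorem3 (R : realType) (p : R) (hp0 : 0 < p) (hp1 : p < 1) :
  (exists phi1 : emso,
      [/\ emso_wf phi1, emso_fo_vars_le phi1 3 &
          ~ converges (fun n => prob_Gnp n p phi1)]) /\
  (exists phi2 : emso,
      [/\ emso_wf phi2, emso_m phi2 = 1%N &
          ~ converges (fun n => prob_Gnp n p phi2)]).
Proof.
pose pol := 2^-1 <= p.
have q_gt0 : 0 < 1 - (if pol then p else 1 - p) by case: pol; lra.
have q_le_half : 1 - (if pol then p else 1 - p) <= 2^-1.
  by rewrite /pol; case: (leP 2^-1 p) => h; move: h; lra.
split.
- exists (phi1 pol); split; [exact: phi1_wf|exact: phi1_fo_vars|].
  apply: (not_converges_prob q_gt0 q_le_half) => [n r|t n r f].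
    exact: phi1_good.
  exact: pattern_phi1.
- exists (phi2 pol); split; [exact: phi2_wf|by []|].
  apply: (not_converges_prob q_gt0 q_le_half) => [n r|t n r f].
    exact: phi2_good.
  exact: pattern_phi2.
Qed.
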